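(* For any $\alpha>0$, there is no natural first-order method (even randomized) for continual finite-sum minimization with FO complexity $O\left(n^{2-\alpha}\log(1/\epsilon)\right)$. Moreover, for any $\alpha<1/4$, there is no natural first-order method for continual finite-sum minimization with FO complexity $O\left(n/\epsilon^{\alpha}\right)$.
   Context: Setting. $\mathcal{D}\subset\mathbb{R}^d$ is nonempty, convex and compact; $\|\cdot\|$ is the Euclidean norm. Each $f_i:\mathcal{D}\to\mathbb{R}$ is differentiable and, for all $x,y\in\mathcal{D}$: $f_i(x)\ge f_i(y)+\nabla f_i(y)^\top(x-y)+\frac{\mu}{2}\|x-y\|^2$ ($\mu$-strong convexity, $\mu>0$); $|f_i(x)-f_i(y)|\le G\|x-y\|$ ($G$-Lipschitz); $\|\nabla f_i(x)-\nabla f_i(y)\|\le L\|x-y\|$ ($L$-smooth). Prefix functions: $g_i(x):=\frac1i\sum_{j=1}^i f_j(x)$ and $x_i^\star:=\arg\min_{x\in\mathcal{D}}g_i(x)$. Continual finite-sum minimization: given differentiable functions $f_1,\dots,f_n:\mathcal{D}\to\mathbb{R}$, each $\mu$-strongly convex, $G$-Lipschitz and $L$-smooth on $\mathcal{D}$, and $\epsilon>0$, output $\hat x_1,\dots,\hat x_n\in\mathcal{D}$ with $g_i(\hat x_i)\le g_i(x_i^\star)+\epsilon$ for each $i\in\{1,\dots,n\}$ (if $\hat x_i$ is random: $\mathbb{E}[g_i(\hat x_i)]-g_i(x_i^\star)\le\epsilon$). A method for this problem must achieve this for every $n$, every $\epsilon$ and every such sequence. First-order method $\mathcal{A}$: $\hat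 x_0\in\mathcal{D}$ denotes its initial point and $\hat x_i\in\mathcal{D}$ its output at stage $i\in\{1,\dots,n\}$. During stage $i$ it performs $T_i$ rounds; $x_i^t\in\mathcal{D}$ denotes its intermediate point at round $t\ge1$ of stage $i$. At each round $t\in\{1,\dots,T_i\}$ of stage $i$ it performs a (possibly random) finite set $Q_i^t$ of first-order oracles (FOs); each $q\in Q_i^t$ has the form $q=(q_{\rm value},q_{\rm index})$, where $q_{\rm value}\in\mathcal{D}$ is the queried point and $q_{\rm index}\le i$ the index of the queried function, and it returns $\nabla f_{q_{\rm index}}(q_{\rm value})$. The method's choices depend on the functions only through the gradients obtained so far (and possibly on internal randomness). The FO complexity of $\mathcal{A}$ is $\sum_{i=1}^n\sum_{t=1}^{T_i}|Q_i^t|$. Natural first-order method: for a set $S\subseteq\mathbb{R}^d$ let $\Pi_{\mathcal{D}}(S):=\{\Pi_{\mathcal{D}}(x):x\in S\}$, where $\Pi_{\mathcal{D}}(x)=\arg\min_{z\in\mathcal{D}}\|x-z\|$. Let $\mathrm{PP}_i^{t}:=\big(\bigcup_{m\le i-1}\bigcup_{\tau\le T_m}\{x_m^\tau\}\big)\cup\big(\bigcup_{\tau\le t}\{x_i^\tau\}\big)\cup\{\hat x_0\}$ (previous points). $\mathcal{A}$ is natural iff at each round $t\in\{1,\dots,T_i\}$ of each stage $i$: (1) every $q\in Q_i^t$ satisfies $q_{\rm index}\le i$ and $q_{\rm value}\in\mathrm{PP}_i^{t-1}$; (2) $x_i^t\in\Pi_{\mathcal{D}}(S)$, where $S$ is the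 linear span of $\{\nabla f_{q_{\rm index}}(q_{\rm value}):q\in Q_i^t\}\cup\mathrm{PP}_i^{t-1}$; and (3) $\hat x_i\in\Pi_{\mathcal{D}}(S)$, where $S$ is the linear span of $\mathrm{PP}_i^{T_i}$. The $O(\cdot)$ is with respect to $n$ and $1/\epsilon$; the hidden constants may depend on $\mu,L,G,|\mathcal{D}|$ and on $\alpha$ but not on $n,\epsilon$. *)

(* Defs.v *)
From HB Require Import structures.
From mathcomp Require Import all_boot all_order all_algebra finmap.
From mathcomp Require Import all_classical all_reals all_analysis.

Set Implicit Arguments.
Unset Strict Implicit.
Unset Printing Implicit Defensive.

Import Order.TTheory GRing.Theory Num.Theory.
Import numFieldNormedType.Exports.

Local Open Scope classical_set_scope.
Local Open Scope ring_scope.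

Section Euclidean.
Variables (R : realType) (d : nat).
Implicit Types (u v x y z : 'rV[R]_d) (D : set 'rV[R]_d) (h : 'rV[R]_d -> R).

Definition dotp u v : R := \sum_(j < d) u 0 j * v 0 j.

(* The norm `|x| that the library puts on 'rV[R]_d is the sup norm. *)
Definition enorm x : R := Num.sqrt (dotp x x).

Definition grad h x : 'rV[R]_d := \row_(j < d) 'D_(delta_mx 0 j) h x.

Definition is_argmin D h z : Prop := D z /\ forall y, D y -> h z <= h y.

Definition proj_image D (A : set 'rV[R]_d) : set 'rV[R]_d :=
  [set z | exists2 x, A x & is_argmin D (fun y => enorm (x - y)) z].

Definition lin_span (X : seq 'rV[R]_d) : set 'rV[R]_d := [set x | x \in <<X>>%VS].

End Euclidean.

Record setting (R : realType) := Setting {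
  dim : nat ;
  dom : set 'rV[R]_dim ;
  mu : R ;
  lipG : R ;
  smoothL : R ;
  dim_gt0 : (0 < dim)%N ;
  dom_nonempty : dom !=set0 ;
  dom_convex : convex_set dom ;
  dom_compact : compact dom ;
  mu_gt0 : 0 < mu }.

Section Problem.
Variables (R : realType) (S : setting R).

Local Notation pt := 'rV[R]_(dim S).
Local Notation D := (@dom R S).

(* A function D -> R is represented by a total function of which only the
   values and gradients at points of D matter.  Asking for differentiability of
   the total function at the points of D loses no generality: D is convex and
   compact, so by Whitney's theorem a function on D whose gradient is Lipschitz
   on D extends to a C^1 function on the whole space with the same gradient
   on D. *)
Definition admissible (h : pt -> R) : Prop :=
  [/\ forall x, D x -> differentiable h x,
      forall x y, D x -> D y ->
        h x >= h y + dotp (grad h y) (x - y) + mu S / 2 * enorm (x - y) ^+ 2,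
      forall x y, D x -> D y -> `|h x - h y| <= lipG S * enorm (x - y) &
      forall x y, D x -> D y ->
        enorm (grad h x - grad h y) <= smoothL S * enorm (x - y)].

(* Sequences f_1, ..., f_n are indexed from 1; f 0 and f j for j > n are junk. *)
Definition instance (n : nat) (f : nat -> pt -> R) : Prop :=
  forall j, (1 <= j <= n)%N -> admissible (f j).

Definition prefix_mean (f : nat -> pt -> R) (i : nat) (x : pt) : R :=
  i%:R^-1 * \sum_(1 <= j < i.+1) f j x.

(* q.1 is the queried point, q.2 the index of the queried function. *)
Definition query : Type := (pt * nat)%type.

Definition answer (f : nat -> pt -> R) (q : query) : pt := grad (f q.2) q.1.

(* One execution: [out 0] is the initial point and [out i] the output of stage
   i; [nrounds i] is T_i; [queries i t] and [point i t] are Q_i^t and x_i^t, and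
   are meaningful for 1 <= t <= T_i only. *)
Record execution := Execution {
  out : nat -> pt ;
  nrounds : nat -> nat ;
  queries : nat -> nat -> {fset query} ;
  point : nat -> nat -> pt }.

(* The rounds (m, tau) of all stages m < i, then the first t ones of stage i. *)
Definition rounds (r : execution) (i t : nat) : seq (nat * nat) :=
  [seq (m, tau) | m <- iota 1 i.-1, tau <- iota 1 (nrounds r m)]
    ++ [seq (i, tau) | tau <- iota 1 t].

Definition previous_points (r : execution) (i t : nat) : seq pt :=
  out r 0%N :: [seq point r p.1 p.2 | p <- rounds r i t].

Definition fo_count (n : nat) (r : execution) : nat :=
  (\sum_(1 <= i < n.+1) \sum_(1 <= t < (nrounds r i).+1) #|` queries r i t|)%N.

Definition well_formed (n : nat) (r : execution) : Prop :=
  [/\ D (out r 0%N),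
      forall i, (1 <= i <= n)%N -> D (out r i),
      forall i t, (1 <= i <= n)%N -> (1 <= t <= nrounds r i)%N ->
        D (point r i t) &
      forall i t q, (1 <= i <= n)%N -> (1 <= t <= nrounds r i)%N ->
        q \in queries r i t -> D q.1 /\ (1 <= q.2 <= i)%N].

Definition same_answers (f f' : nat -> pt -> R) (r : execution) (i t : nat) :
    Prop :=
  forall p q, p \in rounds r i t -> q \in queries r p.1 p.2 ->
    answer f q = answer f' q.

(* If f and f' answer alike all the queries made by r in the rounds up to round
   t of stage i, then r and r' make the same choices until new gradients are
   revealed: x_i^t, then either the next query set or the end of the stage. *)
Definition same_choices (n : nat) (f f' : nat -> pt -> R) (r r' : execution) :
    Prop :=
  out r 0%N = out r' 0%N /\
  forall i t, (1 <= i <= n)%N -> (t <= nrounds r i)%N ->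
    same_answers f f' r i t ->
    [/\ (0 < t)%N -> point r i t = point r' i t,
        (t < nrounds r i)%N = (t < nrounds r' i)%N,
        (t < nrounds r i)%N -> queries r i t.+1 = queries r' i t.+1 &
        t = nrounds r i -> out r i = out r' i].

(* A possibly randomized first-order method for sequences of length n: the
   internal randomness is a sample point w of a probability space, drawn before
   the start, and for each w the choices are a function of the gradients
   obtained so far.  Deterministic methods ignore w.  The last two fields make
   the expectations below meaningful. *)
Record fo_method (n : nat) := FOMethod {
  disp : measure_display ;
  Omega : measurableType disp ;
  Prob : probability Omega R ;
  exec : (nat -> pt -> R) -> Omega -> execution ;
  exec_wf : forall f w, instance n f -> well_formed n (exec f w) ;
  exec_oracle : forall f f' w, instance n f -> instance n f' ->
    same_choices n f f' (exec f w) (exec f' w) ;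
  exec_measurable_out : forall f i j, instance n f -> (1 <= i <= n)%N ->
    measurable_fun [set: Omega] (fun w => out (exec f w) i 0 j) ;
  exec_measurable_count : forall f, instance n f ->
    measurable_fun [set: Omega] (fun w => (fo_count n (exec f w))%:R : R) }.

Arguments Prob {n} _.
Arguments exec {n} _ _ _.

Definition natural_execution (n : nat) (f : nat -> pt -> R) (r : execution) :
    Prop :=
  (forall i t, (1 <= i <= n)%N -> (1 <= t <= nrounds r i)%N ->
     (forall q, q \in queries r i t ->
        (q.2 <= i)%N /\ q.1 \in previous_points r i t.-1) /\
     proj_image D
       (lin_span ([seq answer f q | q <- queries r i t]
                    ++ previous_points r i t.-1)) (point r i t)) /\
  (forall i, (1 <= i <= n)%N ->
     proj_image D (lin_span (previous_points r i (nrounds r i))) (out r i)).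

Definition natural (n : nat) (A : fo_method n) : Prop :=
  forall f w, instance n f -> natural_execution n f (exec A f w).

Definition accurate (n : nat) (eps : R) (A : fo_method n) : Prop :=
  forall f i xstar, instance n f -> (1 <= i <= n)%N ->
    is_argmin D (prefix_mean f i) xstar ->
    ('E_(Prob A)[fun w => prefix_mean f i (out (exec A f w) i)]
       <= (prefix_mean f i xstar + eps)%:E)%E.

(* The method may know n and eps in advance. *)
Definition natural_method (A : forall n : nat, R -> fo_method n) : Prop :=
  forall n eps, (0 < n)%N -> 0 < eps -> natural (A n eps).

Definition solves (A : forall n : nat, R -> fo_method n) : Prop :=
  forall n eps, (0 < n)%N -> 0 < eps -> accurate eps (A n eps).

(* Expected FO complexity O(b n eps) as n and 1/eps are both large.  C, n0 and
   eps0 may depend on the setting S but not on n, eps or the sequence f. *)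
Definition fo_complexity_bigO (A : forall n : nat, R -> fo_method n)
    (b : nat -> R -> R) : Prop :=
  exists (C : R) (n0 : nat) (eps0 : R), 0 < eps0 /\
    forall n eps f, (n0 <= n)%N -> 0 < eps <= eps0 -> instance n f ->
      ('E_(Prob (A n eps))[fun w => (fo_count n (exec (A n eps) f w))%:R]
         <= (C * b n eps)%:E)%E.

End Problem.

(* Main.v *)
(** Information alone gives the lower bound, already in dimension one.  On
[0, 1] take f_j(x) = 3 (x - (2j - 1) / n)^2, so that g_i is minimal at i / n.
Adding to a single f_k, with k <= i, a C^{1,1} bump of width 1 / (4 n) around
i / n moves the minimiser of g_i by order 1 / (n i), while the gradient of f_k
is unchanged away from i / n.  If, by the end of stage i, f_k has not been
queried near i / n, the two instances give the same output at stage i, so that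
the two errors sum up to at least K = 1 / (512 n^4).  The neighbourhoods of the
points i / n are disjoint, hence pointwise in the randomness K times the number
of pairs k <= i is at most K times the number of queries made on the unperturbed
instance plus the errors over all pairs.  With eps = K / 4, integration shows
that the expected number of queries is at least n^2 / 4, which is incompatible
with n^(2 - alpha) log (1 / eps), and with n / eps^alpha for alpha < 1 / 4. *)

Require Import Defs.
From mathcomp Require Import all_boot all_order all_algebra.
From mathcomp Require Import all_classical all_reals all_analysis.
From mathcomp Require Import finmap zify ring lra measurable_realfun.
Set Implicit Arguments.
Unset Strict Implicit.
Unset Printing Implicit Defensive.

Import Order.TTheory GRing.Theory Num.Theory.
Import numFieldNormedType.Exports.
Local Open Scope ring_scope.

(** Strong convexity and smoothness in one condition, stable under sums, shifts and nonnegative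
    scaling. A negative [m] is allowed, so non-convex summands fit too. *)
Definition tangent_bounds {R : realType} (m M : R) (F dF : R -> R) : Prop :=
  forall x y, m * (x - y) ^+ 2 <= F x - F y - dF y * (x - y)
              /\ F x - F y - dF y * (x - y) <= M * (x - y) ^+ 2.

(** * Calculus of quadratic tangent bounds on the real line *)

Section TangentBounds.
Local Open Scope classical_set_scope.
Local Open Scope ring_scope.
Context {R : realType}.
Implicit Types (m M x y a : R) (F dF : R -> R).

Lemma tangent_boundsD m1 M1 F1 dF1 m2 M2 F2 dF2 :
  tangent_bounds m1 M1 F1 dF1 -> tangent_bounds m2 M2 F2 dF2 ->
  tangent_bounds (m1 + m2) (M1 + M2)
    (fun x => F1 x + F2 x) (fun x => dF1 x + dF2 x).
Proof. by move=> h1 h2 x y; have := h1 x y; have := h2 x y; lra. Qed.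

Lemma tangent_bounds_shift m M F dF a :
  tangent_bounds m M F dF ->
  tangent_bounds m M (fun x => F (x - a)) (fun x => dF (x - a)).
Proof.
move=> h x y; have := h (x - a) (y - a).
by have -> : x - a - (y - a) = x - y by ring.
Qed.

Lemma tangent_boundsZ m M F dF a : 0 <= a ->
  tangent_bounds m M F dF ->
  tangent_bounds (a * m) (a * M) (fun x => a * F x) (fun x => a * dF x).
Proof.
move=> a0 h x y.
have -> : a * F x - a * F y - a * dF y * (x - y) =
  a * (F x - F y - dF y * (x - y)) by ring.
by rewrite -!mulrA !ler_wpM2l//; have [] := h x y.
Qed.

Lemma tangent_bounds_scaled_square a :
  tangent_bounds a a (fun x => a * x ^+ 2) (fun x => 2 * a * x).
Proof.
move=> x y.
have -> : a * x ^+ 2 - a * y ^+ 2 - 2 * a * y * (x - y) = a * (x - y) ^+ 2.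
  by ring.
by [].
Qed.

(** The tangent remainder is quadratic in the increment, so the difference quotient converges.
    Piecewise formulas thus get their derivatives from inequalities alone. *)
Lemma tangent_bounds_is_derive m M F dF x :
  tangent_bounds m M F dF -> is_derive x 1 F (dF x).
Proof.
move=> h; pose c := `|m| + `|M| + 1.
have c0 : 0 < c by rewrite ltr_wpDl// addr_ge0.
have bnd t : `|F (x + t) - F x - dF x * t| <= c * t ^+ 2.
  have [] := h (x + t) x; rewrite [x + t - x]addrAC subrr add0r => h1 h2.
  have t2 : 0 <= t ^+ 2 by exact: sqr_ge0.
  have hm : - `|m| <= m by rewrite lerNl -normrN ler_norm.
  have hM : M <= `|M| by exact: ler_norm.
  have m0 := normr_ge0 m; have M0 := normr_ge0 M.
  rewrite ler_norml; apply/andP; split.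
    apply: le_trans h1; rewrite /c -subr_ge0.
    have -> : m * t ^+ 2 - - ((`|m| + `|M| + 1) * t ^+ 2) =
      (m + `|m| + `|M| + 1) * t ^+ 2 by ring.
    by apply: mulr_ge0 => //; lra.
  apply: (le_trans h2); rewrite /c ler_wpM2r//; lra.
have cv : h^-1 *: (F (h *: 1 + x) - F x) @[h --> 0^'] --> dF x.
  apply/cvgrPdist_le => e e0.
  have ec : 0 < e / c by rewrite divr_gt0.
  near=> t.
  have tn0 : t != 0 by near: t; exact: nbhs_dnbhs_neq.
  have te : `|t| <= e / c.
    by near: t; apply: dnbhs0_le.
  have -> : dF x - t^-1 *: (F (t *: 1 + x) - F x) =
      - (t^-1 * (F (x + t) - F x - dF x * t)).
    rewrite /GRing.scale/= mulr1 [t + x]addrC; by field.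
  rewrite normrN normrM normfV ler_pdivrMl ?normr_gt0//.
  apply: le_trans (bnd t) _.
  rewrite -normr_id -real_normK ?num_real// expr2 mulrA [leRHS]mulrC normr_id.
  rewrite ler_wpM2r// mulrC -ler_pdivlMr//.
apply: DeriveDef; first by apply/cvg_ex; exists (dF x).
by apply/cvg_lim.
Unshelve. all: by end_near.
Qed.

End TangentBounds.

(** * The C^{1,1} bump and its slope *)

Section Bump.
Context {R : realType}.
Implicit Types (x y u w : R).

Definition sqpos x : R := Num.max x 0 ^+ 2.

Lemma tangent_bounds_sqpos :
  tangent_bounds 0 1 sqpos (fun x => 2 * Num.max x 0).
Proof.
move=> x y; rewrite /sqpos.
have sx := sqr_ge0 x; have sy := sqr_ge0 y; have sxy := sqr_ge0 (x - y).
case: (leP x 0) => hx; case: (leP y 0) => hy.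
- by split; lra.
- have xy : x * y <= 0 by rewrite mulr_le0_ge0// ltW.
  by split; lra.
- have xy : x * y <= 0 by rewrite mulr_ge0_le0// ltW.
  by split; lra.
- by split; lra.
Qed.

(* The derivative is the tent of height [2 * w] over [-w, w]. *)
Definition smooth_bump w u : R := sqpos (u + w) - 2 * sqpos u + sqpos (u - w).

Definition dbump w u : R :=
  2 * Num.max (u + w) 0 - 4 * Num.max u 0 + 2 * Num.max (u - w) 0.

(** The outer two terms each contribute between 0 and 1, the middle one between -2 and 0. *)
Lemma tangent_bounds_bump w : tangent_bounds (-2) 2 (smooth_bump w) (dbump w).
Proof.
move=> x y; rewrite /smooth_bump /dbump.
have := tangent_bounds_sqpos x y.
have := tangent_bounds_sqpos (x + w) (y + w).
have := tangent_bounds_sqpos (x - w) (y - w).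
have -> : x + w - (y + w) = x - y by ring.
have -> : x - w - (y - w) = x - y by ring.
by lra.
Qed.

(** A second difference of the convex [sqpos]: in the tangent inequalities at [u] with steps [w] and
    [- w] the slopes cancel. *)
Lemma bump_ge0 w u : 0 <= smooth_bump w u.
Proof.
rewrite /smooth_bump; have [h1 _] := tangent_bounds_sqpos (u + w) u.
have [h2 _] := tangent_bounds_sqpos (u - w) u.
move: h1 h2; have -> : u + w - u = w by ring.
have -> : u - w - u = - w by ring.
by lra.
Qed.

(** Right of [w] the bump stays at the plateau [2 * w ^+ 2], so its values differ from 0 there; only
    its gradient is localised, and the oracle returns only gradients. *)
Lemma dbump_out w u : 0 <= w -> w <= `|u| -> dbump w u = 0.
Proof.
move=> w0; rewrite /dbump; case: (ler0P u) => u0 wu.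
  by rewrite !max_r; lra.
by rewrite !max_l; lra.
Qed.

Lemma dbump_bound w u : 0 <= w -> `|dbump w u| <= 2 * w.
Proof.
move=> w0; rewrite ler_norml /dbump.
case: (leP (u + w) 0) => h1; case: (leP u 0) => h2;
  case: (leP (u - w) 0) => h3; apply/andP; split; lra.
Qed.

Lemma measurable_sqpos : measurable_fun [set: R]%classic sqpos.
Proof.
by apply: measurable_funX; apply: measurable_maxr.
Qed.

Lemma measurable_bump w : measurable_fun [set: R]%classic (smooth_bump w).
Proof.
apply: measurable_funD; first apply: measurable_funB.
- by apply: (measurableT_comp measurable_sqpos); apply: measurable_funD.
- by apply: measurable_funM => //; exact: measurable_sqpos.
- by apply: (measurableT_comp measurable_sqpos); apply: measurable_funB.
Qed.

End Bump.

(** * The one-dimensional setting on [0, 1] *)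

Section UnitInterval.
Local Open Scope classical_set_scope.
Local Open Scope ring_scope.
Context {R : realType}.
Implicit Types (x y v : 'rV[R]_1) (F dF : R -> R).

Definition unit_interval : set 'rV[R]_1 := [set v : 'rV[R]_1 | 0 <= v 0 0 <= 1].

Lemma unit_interval_nonempty : unit_interval !=set0.
Proof. by exists 0; rewrite /unit_interval/= mxE lexx ler01. Qed.

Lemma unit_interval_convex : convex_set unit_interval.
Proof.
apply/convex_setW => x y /set_mem /andP[x0 x1] /set_mem /andP[y0 y1] l l0 l1.
apply/mem_set; rewrite /unit_interval/= /conv/= !mxE.
move: l0 l1; set t := l%:num => t0 t1.
rewrite /unstable.onem; apply/andP; split; nra.
Qed.

Lemma unit_interval_compact : compact unit_interval.
Proof.
have -> : unit_interval =
    [set v : 'rV[R]_1 | forall i : 'I_1, [set` `[0, 1]%R] (v ord0 i)].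
  apply/seteqP; split=> v; rewrite /unit_interval => h.
    by move=> i; rewrite (ord1 i) /= in_itv; exact: h.
  by have := h 0; rewrite /= in_itv.
apply: (@rV_compact R 1 (fun=> [set` `[0, 1]%R])) => _.
exact: segment_compact.
Qed.

(** The constants are independent of [n]. Tangent bounds 1 and 5 give [mu / 2 = 1] and [L = 2 * 5];
    30 leaves room above the slopes met below. *)
Definition interval_setting : setting R :=
  @Setting R 1 unit_interval 2 30 10 (ltn0Sn 0) unit_interval_nonempty
    unit_interval_convex unit_interval_compact (ltr0Sn R 1).

Lemma dotp1 x y : dotp x y = x 0 0 * y 0 0.
Proof. by rewrite /dotp big_ord1. Qed.

Lemma enorm1 x : enorm x = `|x 0 0|.
Proof. by rewrite /enorm dotp1 -expr2 sqrtr_sqr. Qed.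

Lemma grad_coord F (x : 'rV[R]_1) (df : R) :
  is_derive (x 0 0) 1 F df -> grad (fun y => F (y 0 0)) x = const_mx df.
Proof.
move=> dF; apply/rowP => j; rewrite ord1 !mxE.
rewrite -(@derive_val _ _ _ _ _ _ _ dF) /derive.
have E h : ((fun y : 'rV[R]_1 => F (y 0 0)) \o shift x) (h *: delta_mx 0 0) =
    (F \o shift (x 0 0)) (h *: 1) by rewrite /= !mxE eqxx.
by under eq_fun do rewrite E.
Qed.

Lemma differentiable_coordF F (x : 'rV[R]_1) :
  derivable F (x 0 0) 1 -> differentiable (fun y => F (y 0 0)) x.
Proof.
move=> /derivable1_diffP dF.
apply: (@differentiable_comp _ _ _ _ (fun y : 'rV[R]_1 => y 0 0) F) => //.
exact: differentiable_coord.
Qed.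

Lemma admissible_coord F dF : tangent_bounds 1 5 F dF ->
  (forall t, 0 <= t <= 1 -> `|dF t| <= 30) ->
  @admissible R interval_setting (fun x => F (x 0 0)).
Proof.
move=> hF hG; rewrite /admissible/=.
have gradF x : grad (fun y : 'rV[R]_1 => F (y 0 0)) x = const_mx (dF (x 0 0)).
  exact/grad_coord/tangent_bounds_is_derive/hF.
split.
- move=> x _; apply: differentiable_coordF.
  by case: (tangent_bounds_is_derive (x 0 0) hF).
- move=> x y _ _; rewrite gradF dotp1 enorm1 !mxE divff// mul1r.
  by rewrite real_normK ?num_real//; have := hF (x 0 0) (y 0 0); lra.
- move=> x y hx hy; rewrite enorm1 !mxE.
  wlog : x y hx hy / F (y 0 0) <= F (x 0 0).
    move=> H; case: (leP (F (y 0 0)) (F (x 0 0))) => [|/ltW] h; first exact: H.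
    by rewrite distrC [in leRHS]distrC; exact: H.
  move=> le_yx; rewrite ger0_norm ?subr_ge0//.
  (* Convexity, with the tangent at the point of larger value, bounds the increase by the slope
     there. *)
  have [h _] := hF (y 0 0) (x 0 0).
  have sq := sqr_ge0 (y 0 0 - x 0 0).
  have d : dF (x 0 0) * (x 0 0 - y 0 0) <= 30 * `|x 0 0 - y 0 0|.
    apply: le_trans (ler_norm _) _; rewrite normrM ler_wpM2r//; exact: hG.
  by nra.
- move=> x y _ _; rewrite !gradF !enorm1 !mxE.
  set a := x 0 0; set b := y 0 0.
  (* Adding the bounds for [(a, b)] and [(b, a)] cancels the values of [F] and leaves
     [(dF a - dF b) * (a - b)], which is at most [10 * (a - b) ^+ 2]. *)
  have [h1 h2] := hF a b; have [h3 h4] := hF b a.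
  have key : `|dF a - dF b| * `|a - b| <= 10 * `|a - b| * `|a - b|.
    rewrite -normrM -mulrA -normrM -!expr2 [in leRHS]ger0_norm ?sqr_ge0//.
    by rewrite ler_norml; apply/andP; split; nra.
  have [->|ab] := eqVneq a b; first by rewrite !subrr normr0 mulr0.
  by move: key; rewrite ler_pM2r// normr_gt0 subr_eq0.
Qed.

End UnitInterval.

(** * The hard instances and the minimisers of their prefix means *)

Section HardInstance.
Context {R : realType} (n : nat).
Hypothesis n_gt0 : (0 < n)%N.
Implicit Types (i j k : nat) (x : 'rV[R]_1).
Local Notation S := (@interval_setting R).
Local Notation mean := (@prefix_mean R S).

Definition center i : R := i%:R / n%:R.

Definition width : R := (4 * n%:R)^-1.

(* The increments 2j - 1 sum up to i ^ 2, so that the mean of the first i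
   functions is minimal at [center i]. *)
Definition base j x : R := 3 * (x 0 0 - ((2 * j)%:R - 1) / n%:R) ^+ 2.

Definition perturbed i k j x : R :=
  if j == k then base j x + smooth_bump width (x 0 0 - center i) else base j x.

Let nR_gt0 : 0 < n%:R :> R. Proof. by rewrite ltr0n. Qed.

Lemma width_gt0 : 0 < width.
Proof. by rewrite invr_gt0 mulr_gt0. Qed.

Lemma width_le : width <= 4^-1.
Proof. by rewrite lef_pV2 ?posrE ?mulr_gt0// ler_peMr// ler1n. Qed.

Lemma center_itv i : (i <= n)%N -> 0 <= center i <= 1.
Proof.
move=> i_n; rewrite /center divr_ge0 ?ler0n//=.
by rewrite ler_pdivrMr// mul1r ler_nat.
Qed.

Lemma center_ge_width i : (0 < i)%N -> width <= center i.
Proof.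
move=> i0; rewrite /width /center invfM mulrC [leRHS]mulrC.
rewrite ler_wpM2l ?invr_ge0//.
have : 1 <= i%:R :> R by rewrite ler1n.
by lra.
Qed.

(** Distinct centers are at least [4 * width] apart, and two windows of radius [width] cannot bridge
    that gap. *)
Lemma centers_separated i j y :
  `|y - center i| < width -> `|y - center j| < width -> i = j.
Proof.
have center_lt k l : (k < l)%N -> center k + 4 * width <= center l.
  move=> kl; rewrite /center /width invfM mulrA mulfV ?pnatr_eq0// -mulrDl.
  by rewrite ler_pM2r ?invr_gt0// natr1 ler_nat.
rewrite !ltr_norml => /andP[hi1 hi2] /andP[hj1 hj2].
by case: (ltngtP i j) => // /center_lt ?; exfalso; lra.
Qed.

Definition base_slope j (t : R) : R := 2 * 3 * (t - ((2 * j)%:R - 1) / n%:R).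

Lemma tangent_bounds_base j :
  tangent_bounds 3 3 (fun t => 3 * (t - ((2 * j)%:R - 1) / n%:R) ^+ 2)
    (base_slope j).
Proof.
exact: (tangent_bounds_shift (((2 * j)%:R - 1) / n%:R)
  (@tangent_bounds_scaled_square R 3)).
Qed.

(** The factor 3 in [base] outweighs the concavity -2 of the bump: [3 - 2 = 1] and [3 + 2 = 5]. *)
Lemma tangent_bounds_perturbed i j :
  tangent_bounds 1 5
    (fun t => 3 * (t - ((2 * j)%:R - 1) / n%:R) ^+ 2
              + smooth_bump width (t - center i))
    (fun t => base_slope j t + dbump width (t - center i)).
Proof.
have := tangent_boundsD (tangent_bounds_base j)
  (tangent_bounds_shift (center i) (@tangent_bounds_bump R width)).
have -> : 3 + -2 = 1 :> R by ring.
by have -> : 3 + 2 = 5 :> R by ring.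
Qed.

Lemma base_slope_le j t : (1 <= j <= n)%N -> 0 <= t <= 1 ->
  `|base_slope j t| <= 12.
Proof.
move=> /andP[j0 jn] /andP[t0 t1].
rewrite /base_slope; set a := _ / n%:R.
have a0 : 0 <= a.
  by rewrite divr_ge0// subr_ge0 ler1n muln_gt0.
have a2 : a <= 2.
  rewrite ler_pdivrMr// natrM.
  have : j%:R <= n%:R :> R by rewrite ler_nat.
  by lra.
rewrite ler_norml; apply/andP; split; lra.
Qed.

Lemma admissible_base j : (1 <= j <= n)%N -> @admissible R S (base j).
Proof.
move=> jn; apply: (@admissible_coord R
  (fun t => 3 * (t - ((2 * j)%:R - 1) / n%:R) ^+ 2) (base_slope j)).
  move=> u v; have := tangent_bounds_base j u v; have := sqr_ge0 (u - v).
  by lra.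
by move=> t t01; have := base_slope_le jn t01; lra.
Qed.

Lemma admissible_perturbed i k j : (1 <= j <= n)%N ->
  @admissible R S (perturbed i k j).
Proof.
move=> jn; have [<-|jk] := eqVneq j k; last first.
  have -> : perturbed i k j = base j.
    by apply/funext => x; rewrite /perturbed (negPf jk).
  exact: admissible_base.
have -> : perturbed i j j =
    fun x => base j x + smooth_bump width (x 0 0 - center i).
  by apply/funext => x; rewrite /perturbed eqxx.
apply: (admissible_coord (tangent_bounds_perturbed i j)) => t t01.
apply: le_trans (ler_normD _ _) _.
have := base_slope_le jn t01; have := width_le.
have := dbump_bound (t - center i) (ltW width_gt0).
by lra.
Qed.

Lemma grad_perturbed i k j x : width <= `|x 0 0 - center i| ->
  grad (perturbed i k j) x = grad (base j) x.
Proof.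
move=> h; have [<-|jk] := eqVneq j k; last first.
  by congr (grad _ _); apply/funext => y; rewrite /perturbed (negPf jk).
have -> : perturbed i j j =
    fun x => base j x + smooth_bump width (x 0 0 - center i).
  by apply/funext => y; rewrite /perturbed eqxx.
rewrite (grad_coord (tangent_bounds_is_derive (x 0 0)
  (tangent_bounds_perturbed i j))).
rewrite (grad_coord (tangent_bounds_is_derive (x 0 0)
  (tangent_bounds_base j))).
by rewrite dbump_out ?addr0// ltW// width_gt0.
Qed.

(** Each difference of squares factors through [x 0 0 - v], and odd numbers sum to a square. The
    free [v] keeps the induction independent of [center i], which moves with [i]. *)
Lemma sum_base i x (v : R) :
  \sum_(1 <= j < i.+1) base j x =
  \sum_(1 <= j < i.+1) base j (const_mx v)
  + 3 * i%:R * (x 0 0 - v) * (x 0 0 + v - 2 * center i).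
Proof.
elim: i => [|i IHi]; first by rewrite !big_geq// mulr0 !mul0r addr0.
rewrite big_nat_recr//= IHi [in RHS]big_nat_recr//= /base /center !mxE.
rewrite natrM -natr1.
by ring.
Qed.

Lemma prefix_mean_base i x : (0 < i)%N ->
  mean base i x =
  mean base i (const_mx (center i))
  + 3 * (x 0 0 - center i) ^+ 2.
Proof.
move=> i0; rewrite /prefix_mean (sum_base i x (center i)) mulrDr; congr (_ + _).
by field; rewrite pnatr_eq0 -lt0n.
Qed.

Lemma prefix_mean_perturbed i k x : (1 <= k <= i)%N ->
  mean (perturbed i k) i x =
  mean base i x
  + i%:R^-1 * smooth_bump width (x 0 0 - center i).
Proof.
move=> /andP[k0 ki]; rewrite /prefix_mean -mulrDr; congr (_ * _).
rewrite (bigD1_seq k) ?mem_index_iota ?iota_uniq ?k0//=.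
rewrite [in RHS](bigD1_seq k) ?mem_index_iota ?iota_uniq ?k0//=.
rewrite {1}/perturbed eqxx addrAC; congr (_ + _ + _).
by apply: eq_bigr => j jk; rewrite /perturbed (negPf jk).
Qed.

(** With [u] the offset from [center i], this solves [6 * u + 2 * (u + width) / i = 0], the critical
    equation on the rising side of the tent. *)
Definition perturbed_argmin i : R := center i - width / (3 * i%:R + 1).

(** The lower tangent bound at the critical point has zero slope and constant [3 - 2 / i], which is
    at least 1. *)
Lemma prefix_mean_perturbed_ge i k x : (1 <= k <= i)%N ->
  mean (perturbed i k) i
    (const_mx (perturbed_argmin i)) + (x 0 0 - perturbed_argmin i) ^+ 2 <=
  mean (perturbed i k) i x.
Proof.
move=> ki; have i0 : (0 < i)%N by case/andP: ki => /leq_trans; apply.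
have iR : 1 <= i%:R :> R by rewrite ler1n.
rewrite !prefix_mean_perturbed// (prefix_mean_base (const_mx _))//.
rewrite (prefix_mean_base x)// !mxE.
set u := x 0 0 - center i.
have -> : perturbed_argmin i - center i = - (width / (3 * i%:R + 1)).
  by rewrite /perturbed_argmin; ring.
have -> : x 0 0 - perturbed_argmin i = u - - (width / (3 * i%:R + 1)).
  by rewrite /perturbed_argmin /u; ring.
set v := - _.
have w0 := width_gt0.
have hv : v * (3 * i%:R + 1) = - width by rewrite /v; field; lra.
have v0 : v <= 0 by rewrite oppr_le0 divr_ge0; lra.
have vw : 0 <= v + width by nra.
have slope : dbump width v = 2 * (v + width).
  by rewrite /dbump max_l ?max_r ?max_r; lra.
have iV0 : 0 <= i%:R^-1 :> R by rewrite invr_ge0.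
have [+ _] := tangent_boundsD (@tangent_bounds_scaled_square R 3)
  (tangent_boundsZ iV0 (@tangent_bounds_bump R width)) u v.
rewrite slope.
have -> : 2 * 3 * v + i%:R^-1 * (2 * (v + width)) = 0.
  have -> : width = - (v * (3 * i%:R + 1)) by rewrite hv opprK.
  by field; lra.
have iV : i%:R^-1 <= 1 :> R by rewrite invf_le1//; lra.
have sq := sqr_ge0 (u - v).
have : i%:R^-1 * (u - v) ^+ 2 <= (u - v) ^+ 2 by rewrite ler_piMl.
by lra.
Qed.

End HardInstance.

(** * Counting the queries of an execution *)

Section Executions.
Context {R : realType} (S : setting R).
Implicit Types (r : execution S).

Definition all_rounds n r : seq (nat * nat) :=
  [seq (m, tau) | m <- iota 1 n, tau <- iota 1 (nrounds r m)].

(** A list rather than a set: a query repeated in several rounds is charged each time. *)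
Definition all_queries n r : seq (query S) :=
  flatten [seq enum_fset (queries r p.1 p.2) | p <- all_rounds n r].

Lemma mem_all_rounds n r p :
  (p \in all_rounds n r) = (1 <= p.1 <= n)%N && (1 <= p.2 <= nrounds r p.1)%N.
Proof.
case: p => m tau; apply/allpairsPdep/andP => /= [[a [b [+ + [-> ->]]]]|[h1 h2]].
  by rewrite !mem_iota !add1n !ltnS.
by exists m, tau; rewrite !mem_iota !add1n !ltnS.
Qed.

Lemma rounds_all_rounds n r i : (1 <= i <= n)%N ->
  {subset rounds r i (nrounds r i) <= all_rounds n r}.
Proof.
move=> /andP[i0 i_n] p; rewrite mem_all_rounds mem_cat.
case/orP => [/allpairsPdep|/mapP].
  move=> [m [tau [+ + ->]]] /=; rewrite !mem_iota => /andP[m0 m1] /andP[t0 t1].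
  by apply/andP; split; lia.
by move=> [tau + ->] /=; rewrite !mem_iota => /andP[t0 t1]; lia.
Qed.

Lemma size_all_queries n r : size (all_queries n r) = fo_count n r.
Proof.
rewrite size_flatten sumnE /shape -map_comp big_map /fo_count /all_rounds.
rewrite big_allpairs_dep /index_iota subn1.
by apply: eq_bigr => i _; rewrite subn1.
Qed.

(** Double counting: after exchanging the sums, each query is charged to at most one element of
    [s]. *)
Lemma fo_count_ge_disjoint (I : eqType) (s : seq I) (hit : I -> pred (query S))
    n r : uniq s ->
  (forall a b q, a \in s -> b \in s -> hit a q -> hit b q -> a = b) ->
  (\sum_(a <- s) has (hit a) (all_queries n r) <= fo_count n r)%N.
Proof.
move=> s_uniq hit_inj; rewrite -size_all_queries.
apply: (@leq_trans (\sum_(a <- s) count (hit a) (all_queries n r))).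
  by apply: leq_sum => a _; rewrite has_count; case: (count _ _).
under eq_bigr do rewrite -sum1_count big_mkcond.
rewrite exchange_big/= -sum1_size; apply: leq_sum => q _.
rewrite -big_mkcond sum1_count -size_filter.
have : uniq [seq a <- s | hit a q] by rewrite filter_uniq.
case E : [seq a <- s | hit a q] => [|a [|b t]]//=.
have mem c : c \in [:: a, b & t] -> hit c q /\ c \in s.
  by rewrite -E mem_filter => /andP.
have [ha sa] := mem a (mem_head _ _).
have [hb sb] := mem b (mem_behead (s := [:: a, b & t]) (mem_head _ _)).
by rewrite (hit_inj a b q)// mem_head.
Qed.

End Executions.

(** * Pairs of a stage and a function index *)

Definition stage_pairs n : seq (nat * nat) :=
  [seq (i, k) | i <- iota 1 n, k <- iota 1 i].

Lemma mem_stage_pairs n p :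
  (p \in stage_pairs n) = (1 <= p.1 <= n)%N && (1 <= p.2 <= p.1)%N.
Proof.
case: p => m tau; apply/allpairsPdep/andP => /= [[a [b [+ + [-> ->]]]]|[h1 h2]].
  by rewrite !mem_iota !add1n !ltnS.
by exists m, tau; rewrite !mem_iota !add1n !ltnS.
Qed.

Lemma uniq_stage_pairs n : uniq (stage_pairs n).
Proof.
apply: allpairs_uniq_dep => [|i _|]; rewrite ?iota_uniq//.
by move=> [i k] [i' k'] _ _ /= [-> ->].
Qed.

Lemma size_stage_pairs n : (n ^ 2 <= 2 * size (stage_pairs n))%N.
Proof.
rewrite size_allpairs_dep; under eq_map do rewrite size_iota.
suff -> : (2 * sumn [seq i | i <- iota 1 n] = n * n.+1)%N by lia.
elim: n => // n IHn.
by rewrite -{1}[n.+1]addn1 iotaD map_cat sumn_cat mulnDr IHn /=; lia.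
Qed.

(** * Bumps that no query detects *)

Section HiddenBump.
Context {R : realType}.
Local Notation S := (@interval_setting R).

Definition hits n (p : nat * nat) (q : query S) : bool :=
  (q.2 == p.2) && (`|(q.1 : 'rV[R]_1) 0 0 - center n p.1| < width n).

Lemma hits_inj n p p' (q : query S) : (0 < n)%N ->
  hits n p q -> hits n p' q -> p = p'.
Proof.
move=> n0; case: p p' => [i k] [i' k'].
move=> /andP[/= /eqP <- hi] /andP[/= /eqP <- hi'].
by rewrite (centers_separated n0 hi hi').
Qed.

(** An unhit query concerns another function or a point where the bump is flat, so both instances
    answer it alike; [same_choices] then applies at the last round of stage [i]. *)
Lemma same_output_of_unhit n i k (r r' : execution S) : (0 < n)%N ->
  (1 <= i <= n)%N ->
  @same_choices R S n (base n) (perturbed n i k) r r' ->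
  ~~ has (hits n (i, k)) (all_queries n r) ->
  out r i = out r' i.
Proof.
move=> n0 i_n [_ same] /hasPn unhit.
have [|_ _ _ ->//] := same i (nrounds r i) i_n (leqnn _).
move=> p q pr qp; have {}qp : q \in all_queries n r.
  apply/flattenP; exists (enum_fset (queries r p.1 p.2)) => //.
  by apply/mapP; exists p => //; exact: rounds_all_rounds pr.
have := unhit q qp; rewrite negb_and -leNgt /answer => /orP[q2|q1].
  congr (grad _ _); apply/funext => x.
  by rewrite /perturbed (negPf q2).
by rewrite grad_perturbed.
Qed.

(* If the outputs agree they are far from one of the two minimisers, which are
   at distance [width / (3 i + 1)]. *)
Lemma unhit_gap n i k (r r' : execution S) : (0 < n)%N ->
  (1 <= i <= n)%N ->
  @same_choices R S n (base n) (perturbed n i k) r r' ->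
  ~~ has (hits n (i, k)) (all_queries n r) ->
  (512 * n%:R ^+ 4)^-1 <=
    3 * ((out r i : 'rV[R]_1) 0 0 - center n i) ^+ 2
    + ((out r' i : 'rV[R]_1) 0 0 - perturbed_argmin n i) ^+ 2.
Proof.
move=> n0 i_n same unhit; rewrite -(same_output_of_unhit n0 i_n same unhit).
set z : R := fun_of_matrix _ _ _.
have -> : z - perturbed_argmin n i =
    (z - center n i) + width n / (3 * i%:R + 1).
  by rewrite /perturbed_argmin; ring.
set u := z - _; set d := _ / _.
have [i1 i2] : 1 <= i%:R :> R /\ i%:R <= n%:R :> R.
  by case/andP: i_n; rewrite ler_nat ler1n.
have nR : 0 < n%:R :> R by lra.
(* Since [1 <= i <= n], [4 * n * (3 * i + 1)] is at most [16 * n ^ 2]. *)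
have hd : (16 * n%:R ^+ 2)^-1 <= d.
  rewrite /d /width -invfM lef_pV2 ?posrE ?mulr_gt0 ?exprn_gt0//; nra.
have -> : (512 * n%:R ^+ 4)^-1 = (16 * n%:R ^+ 2)^-1 ^+ 2 / 2 :> R.
  by field; lra.
have d0 : 0 <= (16 * n%:R ^+ 2)^-1 :> R by rewrite invr_ge0; nra.
have : (16 * n%:R ^+ 2)^-1 ^+ 2 <= d ^+ 2 by rewrite lerXn2r ?nnegrE//; lra.
(* Completing the square: [3 u^2 + (u + d)^2 = (2 u + d / 2)^2 + 3 d^2 / 4]. *)
have := sqr_ge0 (2 * u + d / 2).
have := sqr_ge0 d.
by lra.
Qed.

End HiddenBump.

(** * Averaging over the internal randomness *)

Section Averaging.
Context {d : measure_display} {T : measurableType d} {R : realType}.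
Variable P : probability T R.
Local Open Scope ereal_scope.

(** Here [V] stands for the optimal value and [e] for a pointwise lower bound on the error. As both
    are nonnegative, monotonicity of the integral needs no integrability. *)
Lemma expectation_excess_le (X e : T -> R) (V eps : R) :
  measurable_fun [set: T]%classic X -> measurable_fun [set: T]%classic e ->
  (0 <= V)%R -> (forall w, 0 <= e w)%R -> (forall w, V + e w <= X w)%R ->
  'E_P[X] <= (V + eps)%:E -> \int[P]_w (e w)%:E <= eps%:E.
Proof.
move=> mX me V0 e0 eX; rewrite unlock => EX.
rewrite -(leeD2lE (x := V%:E))//.
apply: le_trans EX.
have -> : V%:E + \int[P]_w (e w)%:E = \int[P]_w (V%:E + (e w)%:E).
  rewrite ge0_integralD//; [| by move=> w _; rewrite lee_fin
                            | exact/measurable_EFinP].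
  by rewrite integral_cst//= probability_setT mule1.
apply: ge0_le_integral => //.
- by move=> w _; rewrite -EFinD lee_fin addr_ge0.
- by apply: emeasurable_funD => //; exact/measurable_EFinP.
- exact/measurable_EFinP.
- by move=> w _; rewrite -EFinD lee_fin.
Qed.

(** Integrating the pointwise inequality, the errors pay at most half of [K * size s]; the count
    must pay the rest. *)
Lemma expectation_count_ge (I : eqType) (s : seq I) (e : I -> T -> R)
    (N : T -> R) (K : R) : (0 < K)%R ->
  measurable_fun [set: T]%classic N -> (forall w, 0 <= N w)%R ->
  (forall a, a \in s -> measurable_fun [set: T]%classic (e a)) ->
  (forall a w, a \in s -> (0 <= e a w)%R) ->
  (forall a, a \in s -> \int[P]_w (e a w)%:E <= (K / 2)%:E) ->
  (forall w, K * (size s)%:R <= \sum_(a <- s) e a w + K * N w)%R ->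
  ((size s)%:R / 2)%:E <= 'E_P[N].
Proof.
move=> K0 mN N0 me e0 eK ineq; rewrite unlock.
have ints : measurable_fun [set: T]%classic (fun w => \sum_(a <- s) e a w)%R /\
    \int[P]_w (\sum_(a <- s) e a w)%:E <= ((size s)%:R * (K / 2))%:E.
  elim: s me e0 eK {ineq} => [|a s IHs] me e0 eK.
    under [X in measurable_fun _ X]eq_fun do rewrite big_nil.
    under eq_integral do rewrite big_nil.
    by rewrite integral0 mul0r; split.
  have [] := IHs.
  - by move=> b bs; apply: me; rewrite in_cons bs orbT.
  - by move=> b w bs; apply: e0; rewrite in_cons bs orbT.
  - by move=> b bs; apply: eK; rewrite in_cons bs orbT.
  move=> ms ints.
  under [X in measurable_fun _ X]eq_fun do rewrite big_cons.
  under eq_integral do rewrite big_cons EFinD.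
  have mea := me a (mem_head a s).
  split; first exact: measurable_funD.
  rewrite ge0_integralD//.
  - rewrite -[size _]/(size s).+1 -add1n natrD mulrDl mul1r EFinD.
    by rewrite leeD// eK// mem_head.
  - by move=> w _; rewrite lee_fin e0// mem_head.
  - exact/measurable_EFinP.
  - move=> w _; rewrite lee_fin big_seq sumr_ge0// => b bs.
    by rewrite e0// in_cons bs orbT.
  - exact/measurable_EFinP.
have [ms sumK] := ints.
have sum0 w : (0 <= \sum_(a <- s) e a w)%R.
  by rewrite big_seq sumr_ge0// => b bs; rewrite e0.
have main : (K * (size s)%:R)%:E <=
    ((size s)%:R * (K / 2))%:E + K%:E * \int[P]_w (N w)%:E.
  apply: (@le_trans _ _
    (\int[P]_w ((\sum_(a <- s) e a w)%:E + K%:E * (N w)%:E))).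
    rewrite -[leLHS]mule1 -(@probability_setT _ _ _ P) -integral_cst//.
    apply: ge0_le_integral => //.
    - by move=> w _; rewrite lee_fin mulr_ge0// ltW.
    - apply: emeasurable_funD; first exact/measurable_EFinP.
      by apply/measurable_EFinP; exact: measurable_funM.
    - by move=> w _; rewrite -EFinM -EFinD lee_fin.
  rewrite ge0_integralD//.
  - rewrite ge0_integralZl_EFin//; [exact: leeD2r| | |exact: ltW].
      by move=> w _; rewrite lee_fin.
    exact/measurable_EFinP.
  - by move=> w _; rewrite lee_fin.
  - exact/measurable_EFinP.
  - by move=> w _; rewrite -EFinM lee_fin mulr_ge0// ltW.
  - by apply/measurable_EFinP; exact: measurable_funM.
have IN0 : 0 <= \int[P]_w (N w)%:E.
  by apply: integral_ge0 => w _; rewrite lee_fin.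
(* An infinite expectation satisfies the claim trivially; otherwise the inequality is one between
   reals. *)
move: main IN0; case: (\int[P]_w (N w)%:E) => [r| |]//; last first.
  by move=> _ _; rewrite leey.
rewrite -EFinM -EFinD !lee_fin => main _.
rewrite -(ler_pM2l K0); lra.
Qed.

End Averaging.

(** * The quadratic lower bound on the expected number of queries *)

Section LowerBound.
Context {R : realType}.
Local Notation S := (@interval_setting R).
Local Notation mean := (@prefix_mean R S).

Lemma instance_base n : (0 < n)%N -> @instance R S n (base n).
Proof. by move=> n0 j; exact: admissible_base. Qed.

Lemma instance_perturbed n i k : (0 < n)%N ->
  @instance R S n (perturbed n i k).
Proof. by move=> n0 j; exact: admissible_perturbed. Qed.

Lemma base_ge0 n j (x : 'rV[R]_1) : 0 <= base n j x.
Proof. by rewrite mulr_ge0// sqr_ge0. Qed.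

Lemma perturbed_ge0 n i k j (x : 'rV[R]_1) : 0 <= perturbed n i k j x.
Proof.
rewrite /perturbed; case: ifP => _; last exact: base_ge0.
by apply: addr_ge0; [exact: base_ge0|exact: bump_ge0].
Qed.

Lemma prefix_mean_ge0 (f : nat -> 'rV[R]_1 -> R) i x :
  (forall j y, 0 <= f j y) -> 0 <= mean f i x.
Proof. by move=> f0; rewrite mulr_ge0 ?invr_ge0// sumr_ge0. Qed.

Lemma base_argmin n i : (0 < n)%N -> (1 <= i <= n)%N ->
  is_argmin unit_interval (mean (base n) i) (const_mx (center n i)).
Proof.
move=> n0 /andP[i0 i_n]; split=> [|y _].
  by rewrite /unit_interval/= mxE center_itv.
by rewrite (prefix_mean_base n y)// lerDl mulr_ge0// sqr_ge0.
Qed.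

(** The shift to the left is at most [width], and [center i] is at least [width], so the minimiser
    stays in [0, 1]. *)
Lemma perturbed_argminP n i k : (0 < n)%N -> (i <= n)%N -> (1 <= k <= i)%N ->
  is_argmin unit_interval (mean (perturbed n i k) i)
    (const_mx (perturbed_argmin n i)).
Proof.
move=> n0 i_n k_i; split=> [|y _]; last first.
  apply: le_trans (prefix_mean_perturbed_ge n0 _ k_i).
  by rewrite lerDl sqr_ge0.
have i0 : (0 < i)%N by case/andP: k_i => /leq_trans; apply.
rewrite /unit_interval/= mxE /perturbed_argmin.
have /andP[c0 c1] := center_itv (R := R) n0 i_n.
have w0 : 0 < width n :> R := width_gt0 n0.
have wc : width n <= center n i :> R := center_ge_width n i0.
have iR : 0 <= i%:R :> R by [].
have d0 : 0 <= width n / (3 * i%:R + 1) :> R by rewrite divr_ge0//; lra.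
have dw : width n / (3 * i%:R + 1) <= width n :> R.
  rewrite ler_pdivrMr; nra.
by apply/andP; split; lra.
Qed.

Lemma expected_fo_count_ge n (A : fo_method S n) : (0 < n)%N ->
  accurate (2048 * n%:R ^+ 4)^-1 A ->
  ((n%:R ^+ 2 / 4)%:E <=
    'E_(Prob A)[fun w => (fo_count n (exec (f0 := A) (base n) w))%:R])%E.
Proof.
move=> n0.
have nR : 0 < n%:R :> R by rewrite ltr0n.
have size_ge : n%:R ^+ 2 / 4 <= (size (stage_pairs n))%:R / 2 :> R.
  have : (n ^ 2)%:R <= (2 * size (stage_pairs n))%:R :> R.
    by rewrite ler_nat size_stage_pairs.
  by rewrite natrX natrM; lra.
pose K : R := (512 * n%:R ^+ 4)^-1.
have K0 : 0 < K by rewrite /K invr_gt0 mulr_gt0 ?exprn_gt0 ?ltr0n.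
(* The accuracy is [K / 4]; the errors on the base and the perturbed instance together stay within
   [K / 2]. *)
have epsK : (2048 * n%:R ^+ 4)^-1 + (2048 * n%:R ^+ 4)^-1 = K / 2.
  by rewrite /K; field; lra.
move=> accA.
pose out1 f i w : R := (out (exec (f0 := A) f w) i : 'rV[R]_1) 0 0.
pose e1 (p : nat * nat) w := 3 * (out1 (base n) p.1 w - center n p.1) ^+ 2.
pose e2 (p : nat * nat) w :=
  (out1 (perturbed n p.1 p.2) p.1 w - perturbed_argmin n p.1) ^+ 2.
have pairP p : p \in stage_pairs n ->
    [/\ (0 < p.1)%N, (1 <= p.1 <= n)%N & (1 <= p.2 <= p.1)%N].
  by rewrite mem_stage_pairs => /andP[h1 h2]; split=> //; case/andP: h1.
have mout f i : @instance R S n f -> (1 <= i <= n)%N ->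
    measurable_fun [set: Omega A]%classic (out1 f i).
  move=> hf hi.
  exact: (exec_measurable_out (f0 := A) (0 : 'I_1) hf hi).
have me1 p : p \in stage_pairs n ->
    measurable_fun [set: Omega A]%classic (e1 p).
  move=> /pairP[_ hp _]; apply: measurable_funM => //; apply: measurable_funX.
  by apply: measurable_funB => //; apply: mout => //; exact: instance_base.
have mout2 p : p \in stage_pairs n ->
    measurable_fun [set: Omega A]%classic (out1 (perturbed n p.1 p.2) p.1).
  by move=> /pairP[_ hp _]; apply: mout => //; exact: instance_perturbed.
have me2 p : p \in stage_pairs n ->
    measurable_fun [set: Omega A]%classic (e2 p).
  move=> hp; apply: measurable_funX.
  by apply: measurable_funB => //; exact: mout2.
have e1_ge0 p w : 0 <= e1 p w by rewrite mulr_ge0// sqr_ge0.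
have e2_ge0 p w : 0 <= e2 p w by rewrite sqr_ge0.
have Ee1 p : p \in stage_pairs n ->
    (\int[Prob A]_w (e1 p w)%:E <= ((2048 * n%:R ^+ 4)^-1)%:E)%E.
  move=> hp; have [p0 hp1 hp2] := pairP p hp.
  have := accA _ _ _ (instance_base n0) hp1 (base_argmin n0 hp1).
  apply: expectation_excess_le => //; last 2 first.
  - by apply: prefix_mean_ge0 => *; exact: base_ge0.
  - by move=> w; rewrite [leRHS](prefix_mean_base).
  - have -> : (fun w => mean (base n) p.1
          (out (exec (f0 := A) (base n) w) p.1)) =
        (fun w => mean (base n) p.1 (const_mx (center n p.1)) + e1 p w).
      by apply/funext => w; rewrite (prefix_mean_base).
    by apply: measurable_funD => //; exact: me1.
  - exact: me1.
have Ee2 p : p \in stage_pairs n ->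
    (\int[Prob A]_w (e2 p w)%:E <= ((2048 * n%:R ^+ 4)^-1)%:E)%E.
  move=> hp; have [p0 hp1 hp2] := pairP p hp.
  have pn : (p.1 <= n)%N by case/andP: hp1.
  have := accA _ _ _ (instance_perturbed p.1 p.2 n0) hp1
    (perturbed_argminP n0 pn hp2).
  apply: expectation_excess_le => //; last 2 first.
  - by apply: prefix_mean_ge0 => *; exact: perturbed_ge0.
  - by move=> w; exact: prefix_mean_perturbed_ge.
  - pose c : R := mean (base n) p.1 (const_mx (center n p.1)).
    pose g t : R := c + 3 * (t - center n p.1) ^+ 2
      + p.1%:R^-1 * smooth_bump (width n) (t - center n p.1).
    have -> : (fun w => mean (perturbed n p.1 p.2) p.1
          (out (exec (f0 := A) (perturbed n p.1 p.2) w) p.1)) =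
        g \o out1 (perturbed n p.1 p.2) p.1.
      apply/funext => w; rewrite (prefix_mean_perturbed n)//.
      by rewrite (prefix_mean_base).
    apply: measurableT_comp; last exact: mout2.
    apply: measurable_funD.
      apply: measurable_funD => //; apply: measurable_funM => //.
      by apply: measurable_funX; apply: measurable_funB.
    apply: measurable_funM => //.
    apply: (measurableT_comp (measurable_bump _)).
    exact: measurable_funB.
  - exact: me2.
apply: (@le_trans _ _ ((size (stage_pairs n))%:R / 2)%:E).
  by rewrite lee_fin.
apply: (expectation_count_ge (e := fun p w => e1 p w + e2 p w) K0) => //.
- by apply: exec_measurable_count; exact: instance_base.
- by move=> p hp; apply: measurable_funD; [exact: me1|exact: me2].
- by move=> p w _; rewrite addr_ge0.
- move=> p hp; under eq_integral do rewrite EFinD.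
  rewrite ge0_integralD//.
  + by rewrite -epsK EFinD leeD// ?Ee1 ?Ee2.
  + by move=> w _; rewrite lee_fin.
  + by apply/measurable_EFinP; exact: me1.
  + by move=> w _; rewrite lee_fin.
  + by apply/measurable_EFinP; exact: me2.
- move=> w; set r := exec (f0 := A) (base n) w.
  (* For a pair that is hit the last term alone supplies [K]; for an unhit one the two errors do, by
     [unhit_gap]. *)
  have hitP p : p \in stage_pairs n ->
      K <= e1 p w + e2 p w + K * (has (hits n p) (all_queries n r))%:R.
    move=> /pairP[_ hp1 hp2]; case: (boolP (has _ _)) => hit.
      by rewrite mulr1 lerDr addr_ge0.
    rewrite mulr0 addr0; case: p hp1 hp2 hit => i k hp1 hp2 hit.
    apply: (unhit_gap n0 hp1 _ hit).
    apply: exec_oracle; [exact: instance_base|exact: instance_perturbed].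
  have -> : K * (size (stage_pairs n))%:R = \sum_(p <- stage_pairs n) K.
    by rewrite big_const_seq count_predT iter_addr addr0 mulr_natr.
  apply: (@le_trans _ _ (\sum_(p <- stage_pairs n)
      (e1 p w + e2 p w + K * (has (hits n p) (all_queries n r))%:R))).
    by rewrite big_seq [leRHS]big_seq; exact: ler_sum.
  rewrite big_split/= lerD2l -mulr_sumr (ler_wpM2l (ltW K0))//.
  rewrite -natr_sum ler_nat.
  apply: fo_count_ge_disjoint; first exact: uniq_stage_pairs.
  by move=> a b q _ _; exact: hits_inj.
Qed.

End LowerBound.

(** * Comparison with the claimed growth rates *)

Section Asymptotics.
Context {R : realType}.
Local Notation S := (@interval_setting R).

Lemma exists_powR_gt (beta M : R) (m : nat) : 0 < beta ->
  exists2 n : nat, (m <= n)%N & M < n%:R `^ beta.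
Proof.
move=> beta0; pose K := `|M| + 1.
have K0 : 0 < K by rewrite ltr_wpDl.
exists (m + (Num.truncn (K `^ beta^-1)).+1)%N; first exact: leq_addr.
apply: (@lt_trans _ _ K).
  by rewrite /K; have := ler_norm M; lra.
have KE : K = (K `^ beta^-1) `^ beta.
  by rewrite -powRrM mulVf ?gt_eqF// powRr1// ltW.
rewrite {1}KE; apply: gt0_ltr_powR => //; rewrite ?nnegrE ?powR_ge0 ?ler0n//.
apply: lt_le_trans (truncnS_gt _) _.
by rewrite ler_nat leq_addl.
Qed.

(** Along the accuracies [1 / (2048 n^4)] the claimed bound is of order [n^(2 - beta)], below
    [n^2 / 4] for large [n]. *)
Lemma no_subquadratic_method (beta M : R) (b : nat -> R -> R)
    (A : forall n : nat, R -> fo_method S n) : 0 < beta ->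
  (forall n, (0 < n)%N ->
     0 <= b n (2048 * n%:R ^+ 4)^-1 <= M * n%:R `^ (2 - beta)) ->
  solves A -> ~ fo_complexity_bigO A b.
Proof.
move=> beta0 hb solA [C [n0 [eps0 [eps0_gt0 cplx]]]].
(* The threshold is the one contradicted at the end; the lower bound on [n] secures [n0 <= n] and
   [1 / eps0 < n], whence [eps <= eps0]. *)
have [n] := exists_powR_gt (4 * `|C| * M)
  (n0 + (Num.truncn eps0^-1).+1)%N beta0.
move=> n_ge large.
have n_gt0 : (0 < n)%N by lia.
have n_n0 : (n0 <= n)%N by lia.
have n1 : 1 <= n%:R :> R by rewrite ler1n.
have nR : 0 < n%:R :> R by lra.
have n4 : n%:R <= 2048 * n%:R ^+ 4 :> R.
  have : n%:R ^+ 1 <= n%:R ^+ 4 :> R by rewrite ler_weXn2l.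
  by rewrite expr1; have := exprn_gt0 4 nR; lra.
pose eps : R := (2048 * n%:R ^+ 4)^-1.
have eps_gt0 : 0 < eps by rewrite /eps invr_gt0; lra.
have eps_le : eps <= eps0.
  have n4_gt0 : 0 < 2048 * n%:R ^+ 4 :> R by lra.
  rewrite /eps -(invrK eps0) lef_pV2 ?posrE ?invr_gt0//.
  apply: le_trans n4; apply/ltW/(lt_le_trans (truncnS_gt _)).
  by rewrite ler_nat; exact: leq_trans (leq_addl _ _) n_ge.
have eps_itv : 0 < eps <= eps0 by rewrite eps_gt0.
have := le_trans (expected_fo_count_ge n_gt0 (solA n eps n_gt0 eps_gt0))
  (cplx n eps (base n) n_n0 eps_itv (instance_base n_gt0)).
rewrite lee_fin => lower.
have /andP[b0 bM] := hb n n_gt0; rewrite -/eps in b0 bM.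
have p0 : 0 < n%:R `^ beta :> R by exact: powR_gt0.
have {}bM : b n eps * n%:R `^ beta <= M * n%:R ^+ 2.
  rewrite -powR_mulrn ?ler0n//.
  have -> : n%:R `^ 2%:R = n%:R `^ (2 - beta) * n%:R `^ beta :> R.
    by rewrite -powRD ?subrK// gt_eqF ?implybT.
  by rewrite mulrA ler_wpM2r// ltW.
(* The hidden constant has no prescribed sign, hence the absolute value. *)
have Cb : C * b n eps <= `|C| * b n eps by rewrite ler_wpM2r// ler_norm.
have n2 : 0 < n%:R ^+ 2 :> R by rewrite exprn_gt0.
have h1 : n%:R ^+ 2 / 4 * n%:R `^ beta <= `|C| * b n eps * n%:R `^ beta.
  by rewrite ler_wpM2r//; exact: le_trans lower Cb.
have h2 : `|C| * b n eps * n%:R `^ beta <= `|C| * (M * n%:R ^+ 2).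
  by rewrite -mulrA ler_wpM2l.
have : 4 * `|C| * M * n%:R ^+ 2 < n%:R `^ beta * n%:R ^+ 2.
  by rewrite ltr_pM2r.
by lra.
Qed.

(** From [ln y < y] at [y = c] and at [y = n^(alpha / 2)]; the latter gives
    [4 ln n <= (8 / alpha) n^(alpha / 2)]. *)
Lemma ln_scaled_pow4_bounds (c alpha : R) (n : nat) :
  1 <= c -> 0 < alpha -> (0 < n)%N ->
  0 <= ln (c * n%:R ^+ 4) <= (c + 8 / alpha) * n%:R `^ (alpha / 2).
Proof.
move=> c1 alpha0 n_gt0.
have n1 : 1 <= n%:R :> R by rewrite ler1n.
have nR : 0 < n%:R :> R by lra.
have n4 : 1 <= n%:R ^+ 4 :> R by rewrite exprn_ege1.
have c0 : 0 < c by lra.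
have cn : 1 <= c * n%:R ^+ 4 by rewrite mulr_ege1.
rewrite ln_ge0//= lnM ?posrE ?exprn_gt0// lnXn//.
have np1 : 1 <= n%:R `^ (alpha / 2) :> R.
  by rewrite -[leLHS](powRr0 n%:R) ler_powR//; lra.
have l1 : ln c <= c by apply/ltW/ln_sublinear.
have l2 : alpha / 2 * ln n%:R <= n%:R `^ (alpha / 2).
  by rewrite -ln_powR; apply/ltW/ln_sublinear/powR_gt0.
have l3 : 4 * ln n%:R <= 8 / alpha * n%:R `^ (alpha / 2).
  have -> : 4 * ln n%:R = 8 / alpha * (alpha / 2 * ln n%:R).
    by field; lra.
  by rewrite ler_wpM2l// divr_ge0//; lra.
have l4 : c <= c * n%:R `^ (alpha / 2) by rewrite ler_peMr// ltW.
by lra.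
Qed.

End Asymptotics.

Theorem theorem3 (R : realType) :
  (forall alpha : R, 0 < alpha ->
     ~ exists A : forall (S : setting R) (n : nat), R -> fo_method S n,
         forall S : setting R,
           [/\ natural_method (A S), solves (A S) &
               fo_complexity_bigO (A S)
                 (fun n eps => n%:R `^ (2 - alpha) * ln (1 / eps))]) /\
  (forall alpha : R, alpha < 1 / 4 ->
     ~ exists A : forall (S : setting R) (n : nat), R -> fo_method S n,
         forall S : setting R,
           [/\ natural_method (A S), solves (A S) &
               fo_complexity_bigO (A S)
                 (fun n eps => n%:R / eps `^ alpha)]).
Proof.
split=> alpha halpha [A /(_ interval_setting) [_ solA]].
(* Half of [alpha] absorbs the logarithm, the other half remains as the gain over [n^2]. *)
- apply: (no_subquadratic_method (beta := alpha / 2)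
    (M := 2048 + 8 / alpha)) solA => [|n n_gt0]; first by lra.
  rewrite div1r invrK.
  have c1 : 1 <= 2048 :> R by lra.
  have := ln_scaled_pow4_bounds c1 halpha n_gt0.
  move: (2048 : R) => c /andP[l0 lM].
  rewrite mulr_ge0 ?powR_ge0//=.
  have -> : 2 - alpha / 2 = (2 - alpha) + alpha / 2 by lra.
  rewrite [in leRHS]powRD ?pnatr_eq0 -?lt0n ?n_gt0 ?implybT//.
  by rewrite [leRHS]mulrCA ler_wpM2l// powR_ge0.
(* Here [n / eps^alpha] equals [2048^alpha * n^(1 + 4 alpha)], and [beta] is positive exactly when
   [alpha < 1 / 4]. *)
- apply: (no_subquadratic_method (beta := 1 - 4 * alpha)
    (M := 2048 `^ alpha)) solA => [|n n_gt0]; first by lra.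
  have nR : 0 < n%:R :> R by rewrite ltr0n.
  have : 0 <= 2048 :> R by lra.
  move: (2048 : R) => c c0.
  have n40 : 0 <= c * n%:R ^+ 4 by rewrite mulr_ge0// exprn_ge0// ltW.
  rewrite divr_ge0 ?powR_ge0 ?ler0n//=.
  have -> : (c * n%:R ^+ 4)^-1 `^ alpha = ((c * n%:R ^+ 4) `^ alpha)^-1.
    by rewrite -[in LHS]powR_inv1// -powRrM mulN1r powRN.
  rewrite invrK.
  have nR0 := ltW nR; rewrite powRM ?exprn_ge0// -powR_mulrn// -powRrM.
  have -> : 2 - (1 - 4 * alpha) = 1 + 4 * alpha by lra.
  have n_neq0 : n%:R != 0 :> R by rewrite gt_eqF.
  have -> : n%:R `^ (1 + 4 * alpha) = n%:R * n%:R `^ (4 * alpha) :> R.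
    by rewrite (powRD (r := 1)) ?powRr1 ?n_neq0 ?implybT.
  by rewrite mulrCA.
Qed.
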